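(* Let $t_0,y_0 \in \mathbb{R}$, and assume that there exist constants $a,b,L \in (0,+\infty)$ such that the function $$f:[t_0,t_0+a] \times [y_0-b,y_0+b] \to \mathbb{R}$$ is continuous and $|f(t,y)| \le L$ for all $(t,y) \in [t_0,t_0+a] \times [y_0-b,y_0+b]$. Let $c=\min\{a,b/L\}$ and $I=[t_0,t_0+c]$. Then there exist solutions $\varphi_*,\varphi^*:I \to \mathbb{R}$ of the initial value problem $$y'=f(t,y), \quad y(t_0)=y_0,$$ such that every solution $\varphi:I \to \mathbb{R}$ of this problem satisfies $$\varphi_*(t) \le \varphi(t) \le \varphi^*(t) \quad \text{for all } t \in I.$$
   Context: A solution of the initial value problem on $I$ is a function $\varphi:I \to \mathbb{R}$ which is differentiable in $I$ (with one-sided derivatives at the endpoints of $I$), whose graph is contained in the domain of $f$, and such that $\varphi(t_0)=y_0$ and $\varphi'(t)=f(t,\varphi(t))$ for all $t \in I$. *)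

(* Defs.v *)
From mathcomp Require Import all_boot all_order all_algebra.
From mathcomp Require Import all_classical all_reals all_analysis.
Import Order.TTheory GRing.Theory Num.Theory.
Import numFieldNormedType.Exports.

Set Implicit Arguments.
Unset Strict Implicit.
Unset Printing Implicit Defensive.

Local Open Scope classical_set_scope.
Local Open Scope ring_scope.

(* Only the values of phi on [u, v] matter: the limits at the endpoints are
   one-sided, and the derivative at an interior point only depends on the
   germ of phi there. *)
Definition has_derivative_on (R : realType) (u v : R) (phi dphi : R -> R)
    : Prop :=
  [/\ forall t : R, t \in `]u, v[ -> is_derive t 1 phi (dphi t),
      (phi s - phi u) / (s - u) @[s --> u^'+] --> dphi u
    & (phi s - phi v) / (s - v) @[s --> v^'-] --> dphi v].

(* A function on a subset D of the plane (resp. on [u, v]) is represented by a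
   total function, whose values outside D (resp. [u, v]) are irrelevant. *)
Definition is_solution (R : realType) (D : set (R * R)) (f : R * R -> R)
    (t0 y0 u v : R) (phi : R -> R) : Prop :=
  [/\ forall t : R, t \in `[u, v] -> D (t, phi t),
      phi t0 = y0
    & has_derivative_on u v phi (fun t => f (t, phi t))].

(* Main.v *)
(* Call u an h-approximate solution if all its difference quotients satisfy, up
   to an additive error of order h, every bound that f satisfies near the
   corresponding piece of its graph. Euler step functions are h-approximate
   solutions, and exact solutions are h-approximate for every h > 0. The
   pointwise limit Phi, as h tends to 0, of the supremum of all h-approximate
   solutions is therefore well defined and dominates every solution.
   It is itself a solution: given s and t, there are h-approximate solutions
   u with u(t) close to Phi(t) and u(s) at most slightly above Phi(s), hence
   Phi(s) - Phi(t) >= f(t, Phi(t)) (s - t) - o(s - t); exchanging s and t gives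
   the opposite inequality. No Ascoli-type compactness is used. The minimal
   solution is the maximal one for (t, y) |-> - f(t, - y). *)
Require Import Defs.
From mathcomp Require Import all_boot all_order all_algebra.
From mathcomp Require Import all_classical all_reals all_analysis.
From mathcomp Require Import ring lra.
Import Order.TTheory GRing.Theory Num.Theory.
Import numFieldNormedType.Exports.

Set Implicit Arguments.
Unset Strict Implicit.
Unset Printing Implicit Defensive.

Local Open Scope classical_set_scope.
Local Open Scope ring_scope.

(** * Differentiability on a closed interval, without quotients *)

(** Clearing the denominator admits [s = t] and treats the interior and both endpoints alike, all
    points being taken in [[u, v]]. *)
Definition eps_derivative_on (R : realType) (u v : R) (phi dphi : R -> R) :=
  forall t : R, u <= t <= v -> forall e : R, 0 < e ->
  exists2 d : R, 0 < d & forall s : R, u <= s <= v -> `|s - t| <= d ->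
    `|phi s - phi t - dphi t * (s - t)| <= e * `|s - t|.

Lemma slope_dist (R : realType) (x p h e : R) : h != 0 ->
  (`|p - x / h| <= e) = (`|x - p * h| <= e * `|h|).
Proof.
move=> h0; rewrite -(ler_pM2r (_ : 0 < `|h|)) ?normr_gt0// -normrM mulrBl.
by rewrite divfK// distrC.
Qed.

Lemma has_derivative_on_eps (R : realType) (u v : R) (phi dphi : R -> R) :
  u < v -> has_derivative_on u v phi dphi -> eps_derivative_on u v phi dphi.
Proof.
move=> uv [Hin Hu Hv] t /andP[ut tv] e e0.
have [tu|tu] := eqVneq t u.
  subst t; move/cvgrPdist_le : Hu => /(_ _ e0).
  (* Balls are open, while [eps_derivative_on] uses a non-strict inequality: hence half the
     radius. *)
  move=> [/= d d0 Hd]; exists (d / 2); first by rewrite divr_gt0.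
  move=> s /andP[us sv] sd.
  have [->|su] := eqVneq s u; first by rewrite !subrr mulr0 subrr normr0 mulr0.
  rewrite -slope_dist ?subr_eq0//; apply: Hd.
    by rewrite /= distrC (le_lt_trans sd)//; lra.
  by rewrite lt_neqAle eq_sym su.
have [tv'|tv'] := eqVneq t v.
  subst t; move/cvgrPdist_le : Hv => /(_ _ e0).
  move=> [/= d d0 Hd]; exists (d / 2); first by rewrite divr_gt0.
  move=> s /andP[us sv] sd.
  have [->|su] := eqVneq s v; first by rewrite !subrr mulr0 subrr normr0 mulr0.
  rewrite -slope_dist ?subr_eq0//; apply: Hd.
    by rewrite /= distrC (le_lt_trans sd)//; lra.
  by rewrite lt_neqAle su.
have /Hin/is_derive1_caratheodory[g [Hg gc gt]] : t \in `]u, v[.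
  by rewrite in_itv/= !lt_neqAle eq_sym tu ut tv' tv.
move/cvgrPdist_le : gc => /(_ _ e0)[/= d d0 Hd].
exists (d / 2); first by rewrite divr_gt0.
move=> s _ sd; rewrite Hg -gt -mulrBl normrM ler_wpM2r// distrC; apply: Hd.
by rewrite /= distrC (le_lt_trans sd)//; lra.
Qed.

Lemma eps_has_derivative_on (R : realType) (u v : R) (phi dphi : R -> R) :
  u < v -> eps_derivative_on u v phi dphi -> has_derivative_on u v phi dphi.
Proof.
move=> uv H; split.
- move=> t; rewrite in_itv/= => /andP[ut tv]; apply/is_derive1_caratheodory.
  (* Carathéodory's criterion: the difference quotient, extended by [dphi t] at [t], is continuous
     there. *)
  exists (fun z => if z == t then dphi t else (phi z - phi t) / (z - t)).
  split; last by rewrite eqxx.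
    move=> z; case: eqVneq => [->|zt]; first by rewrite !subrr mulr0.
    by rewrite divfK// subr_eq0.
  apply/cvgrPdist_le => e e0; rewrite eqxx.
  have [d d0 Hd] := H t (ltac:(lra)) e e0.
  exists (Num.min d (Num.min (t - u) (v - t))).
    by rewrite /= !lt_min d0 !subr_gt0 ut.
  move=> z /=; rewrite distrC !lt_min !ltr_norml => /and3P[? ? ?].
  case: eqVneq => [_|zt]; first by rewrite subrr normr0 ltW.
  rewrite slope_dist ?subr_eq0//; apply: Hd; first lra.
  by rewrite ler_norml; lra.
- apply/cvgrPdist_le => e e0.
  have [d d0 Hd] := H u (ltac:(lra)) e e0.
  exists (Num.min d (v - u)); first by rewrite /= lt_min d0 subr_gt0.
  move=> z /=; rewrite distrC !lt_min !ltr_norml => /andP[? ?] uz.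
  rewrite slope_dist; last lra.
  by apply: Hd; [lra|rewrite ler_norml; lra].
- apply/cvgrPdist_le => e e0.
  have [d d0 Hd] := H v (ltac:(lra)) e e0.
  exists (Num.min d (v - u)); first by rewrite /= lt_min d0 subr_gt0.
  move=> z /=; rewrite distrC !lt_min !ltr_norml => /andP[? ?] uz.
  rewrite slope_dist; last lra.
  by apply: Hd; [lra|rewrite ler_norml; lra].
Qed.

Lemma eps_derivative_on_continuous (R : realType) (u v : R) (phi dphi : R -> R) :
  eps_derivative_on u v phi dphi -> {within `[u, v], continuous phi}.
Proof.
move=> H; apply/subspace_continuousP => t; rewrite /= in_itv/= => tuv.
(* Error [1] in the derivative estimate bounds the increment from [t] by
   [(1 + |dphi t|) |s - t|]. *)
apply/cvgrPdist_le => e e0; have [d d0 Hd] := H t tuv 1 ltr01.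
have K0 : 0 < 1 + `|dphi t| by rewrite ltr_pwDl.
exists (Num.min d (e / (1 + `|dphi t|))); first by rewrite /= lt_min d0 divr_gt0.
move=> s /=; rewrite distrC lt_min ltr_pdivlMr// => /andP[sd se].
rewrite in_itv/= => suv; rewrite distrC.
have := Hd s suv (ltW sd); rewrite mul1r => {}Hd.
have -> : phi s - phi t = (phi s - phi t - dphi t * (s - t)) + dphi t * (s - t).
  by ring.
apply: le_trans (ltW se); rewrite [leRHS]mulrDr mulr1.
by rewrite (le_trans (ler_normD _ _))// lerD// normrM mulrC.
Qed.

(** The mean value theorem yields a slope [dphi r] with [r] strictly between [s] and [t], in
    whichever order they come, so that [|r - t| <= |s - t|]. *)
Lemma mean_value_ineq (R : realType) (u v : R) (phi dphi : R -> R)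
    (s t p e : R) :
  has_derivative_on u v phi dphi -> u <= s <= v -> u <= t <= v ->
  (forall r : R, u <= r <= v -> `|r - t| <= `|s - t| -> `|dphi r - p| <= e) ->
  `|phi s - phi t - p * (s - t)| <= e * `|s - t|.
Proof.
have main (s' t' : R) : has_derivative_on u v phi dphi ->
    u <= s' -> t' <= v -> s' < t' ->
    exists2 r, s' < r < t' & phi t' - phi s' = dphi r * (t' - s').
  move=> D us tv st.
  have uv : u < v by lra.
  have C : {within `[s', t'], continuous phi}.
    apply: continuous_subspaceW (eps_derivative_on_continuous
      (has_derivative_on_eps uv D)).
    by move=> x /=; rewrite !in_itv/=; lra.
  have Din x : x \in `]s', t'[ -> is_derive x 1 phi (dphi x).
    have [+ _ _] := D; rewrite in_itv/= => + xst; apply.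
    by rewrite in_itv/=; lra.
  by have [r + E] := MVT st Din C; rewrite in_itv/= => rst; exists r.
move=> D suv tuv H; have [st|ts|->] := ltgtP s t.
- have [r rst] := main s t D (ltac:(lra)) (ltac:(lra)) st.
  move=> E; have -> : phi s - phi t = dphi r * (s - t).
    by rewrite -[LHS]opprB E; ring.
  rewrite -mulrBl normrM ler_wpM2r//; apply: H; first lra.
  by rewrite ler_norml ltr0_norm; lra.
- have [r rst] := main t s D (ltac:(lra)) (ltac:(lra)) ts.
  move=> ->; rewrite -mulrBl normrM ler_wpM2r//; apply: H; first lra.
  by rewrite ler_norml gtr0_norm; lra.
- by rewrite !subrr mulr0 subrr normr0 mulr0.
Qed.

(** Used to let [h] tend to 0 in estimates that hold up to a multiple of [h]. *)
Lemma le_of_le_small (R : realType) (x y C g : R) : 0 <= C -> 0 < g ->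
  (forall h : R, 0 < h -> h <= g -> x <= y + C * h) -> x <= y.
Proof.
move=> C0 g0 H; apply/ler_addgt0Pl => e e0; rewrite addrC.
have C1 : 0 < C + 1 by rewrite ltr_wpDl.
have := H (Num.min g (e / (C + 1))).
rewrite lt_min g0 divr_gt0// ge_min lexx => /(_ isT isT)/le_trans; apply.
rewrite lerD2l; apply: (@le_trans _ _ (C * (e / (C + 1)))).
  by rewrite ler_wpM2l// ge_min lexx orbT.
by rewrite mulrA ler_pdivrMr// mulrC ler_wpM2l ?lerDl// ltW.
Qed.

(** * Approximate solutions *)

Definition bounded_on_rect (R : realType) (t0 t1 y0 b L : R) (f : R * R -> R) :=
  forall t y : R, t0 <= t <= t1 -> `|y - y0| <= b -> `|f (t, y)| <= L.

Definition continuous_on_rect (R : realType) (t0 t1 y0 b : R) (f : R * R -> R) :=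
  forall t y : R, t0 <= t <= t1 -> `|y - y0| <= b -> forall e : R, 0 < e ->
  exists2 d : R, 0 < d & forall r z : R, t0 <= r <= t1 -> `|z - y0| <= b ->
    `|r - t| <= d -> `|z - y| <= d -> `|f (r, z) - f (t, y)| <= e.

Definition eps_solution (R : realType) (t0 t1 y0 b : R) (f : R * R -> R)
    (phi : R -> R) :=
  [/\ forall t : R, t0 <= t <= t1 -> `|phi t - y0| <= b,
      phi t0 = y0
    & eps_derivative_on t0 t1 phi (fun t => f (t, phi t))].

(* No order is assumed between s and t, so that the same condition bounds
   difference quotients to the right and to the left of t. *)
Definition approx_solution (R : realType) (t0 t1 y0 b L : R) (f : R * R -> R)
    (h : R) (u : R -> R) :=
  [/\ forall t : R, t0 <= t <= t1 -> `|u t - y0| <= b,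
      u t0 = y0
    & forall s t p e : R, t0 <= s <= t1 -> t0 <= t <= t1 ->
      (forall r y : R, t0 <= r <= t1 -> `|y - y0| <= b ->
        `|r - t| <= `|s - t| + h -> `|y - u t| <= L * (`|s - t| + h) ->
        `|f (r, y) - p| <= e) ->
      `|u s - u t - p * (s - t)| <= e * `|s - t| + (`|p| + e) * h].

(** A larger [h] demands more of [p] and [e], since the box grows, and tolerates a larger error. *)
Lemma approx_solution_le (R : realType) (t0 t1 y0 b L : R) (f : R * R -> R)
    (h h' : R) (u : R -> R) : 0 < L -> 0 < h -> h <= h' ->
  approx_solution t0 t1 y0 b L f h u -> approx_solution t0 t1 y0 b L f h' u.
Proof.
move=> L0 h0 hh' [ub u0 H]; split=> // s t p e sI tI K.
(* The centre [(t, u t)] of the box is itself a point where [e] bounds an absolute value. *)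
have e0 : 0 <= e.
  apply: le_trans (K t (u t) tI (ub _ tI) _ _); rewrite ?subrr ?normr0 //.
    by rewrite addr_ge0//; lra.
  by rewrite mulr_ge0// ?addr_ge0//; lra.
apply: le_trans (H s t p e sI tI _) _.
  move=> r y rI yI rt yt; apply: K => //; first lra.
  by apply: le_trans yt _; rewrite ler_wpM2l// ?lerD2l// ltW.
by rewrite lerD2l ler_wpM2l// addr_ge0.
Qed.

(** An exact solution is [L]-Lipschitz, so its graph between [s] and [t] stays in the box around
    [(t, phi t)], and the mean value inequality applies. *)
Lemma eps_solution_approx (R : realType) (t0 t1 y0 b L : R) (f : R * R -> R)
    (h : R) (phi : R -> R) : t0 < t1 -> 0 < L -> 0 < h ->
  bounded_on_rect t0 t1 y0 b L f ->
  eps_solution t0 t1 y0 b f phi -> approx_solution t0 t1 y0 b L f h phi.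
Proof.
move=> t01 L0 h0 fL [phib phi0 D]; split=> // s t p e sI tI K.
have {}D := eps_has_derivative_on t01 D.
have lip r : t0 <= r <= t1 -> `|phi r - phi t| <= L * `|r - t|.
  move=> rI; have := mean_value_ineq (p := 0) (e := L) D rI tI.
  rewrite mul0r subr0; apply=> x xI _; rewrite subr0; apply: fL => //.
  exact: phib.
have e0 : 0 <= e.
  apply: le_trans (K t (phi t) tI (phib _ tI) _ _); rewrite ?subrr ?normr0 //.
    by rewrite addr_ge0//; lra.
  by rewrite mulr_ge0// ?addr_ge0//; lra.
apply: le_trans (mean_value_ineq (p := p) (e := e) D sI tI _) _.
  move=> r rI rt; apply: K => //; first exact: phib.
    by rewrite (le_trans rt)// lerDl ltW.
  apply: le_trans (lip r rI) _; rewrite ler_wpM2l//; first exact: ltW.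
  by rewrite (le_trans rt)// lerDl ltW.
by rewrite lerDl mulr_ge0// ?addr_ge0// ltW.
Qed.

(** * Euler step functions *)

Fixpoint euler (R : realType) (f : R * R -> R) (t0 y0 h : R) (n : nat) : R :=
  if n is k.+1 then
    euler f t0 y0 h k + h * f (t0 + k%:R * h, euler f t0 y0 h k)
  else y0.

Lemma euler_bound (R : realType) (t0 t1 y0 b L : R) (f : R * R -> R)
    (h : R) (n : nat) : 0 < L -> 0 < h -> L * (t1 - t0) <= b ->
  bounded_on_rect t0 t1 y0 b L f -> t0 + n%:R * h <= t1 ->
  `|euler f t0 y0 h n - y0| <= b.
Proof.
move=> L0 h0 Lb fL nt.
(* The induction needs this bound, which grows with time; it stays below [b] up to [t1]. *)
suff : `|euler f t0 y0 h n - y0| <= L * (n%:R * h).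
  move=> /le_trans; apply; apply: le_trans Lb; rewrite ler_wpM2l//; lra.
elim: n nt => [|n IH] /= nt; first by rewrite subrr normr0 mul0r mulr0.
have nn : n.+1%:R * h = n%:R * h + h by rewrite -natr1 mulrDl mul1r.
have nh0 : 0 <= n%:R * h by rewrite mulr_ge0// ltW.
rewrite nn in nt *; have {}IH := IH (ltac:(lra)).
rewrite addrAC mulrDr (le_trans (ler_normD _ _))// lerD//.
rewrite normrM gtr0_norm// mulrC ler_wpM2r//; first exact: ltW.
apply: fL; first lra.
by apply: le_trans IH _; apply: le_trans Lb; rewrite ler_wpM2l//; lra.
Qed.

(** Discrete mean value inequality: the increment is a sum of steps of length [h], each with slope
    within [e] of [p]. *)
Lemma euler_increment (R : realType) (f : R * R -> R) (t0 y0 h p e : R)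
    (j k : nat) : 0 < h -> (j <= k)%N ->
  (forall i : nat, (j <= i < k)%N ->
    `|f (t0 + i%:R * h, euler f t0 y0 h i) - p| <= e) ->
  `|euler f t0 y0 h k - euler f t0 y0 h j - p * (k%:R * h - j%:R * h)|
    <= e * (k%:R * h - j%:R * h).
Proof.
move=> h0; elim: k => [|k IH].
  by rewrite leqn0 => /eqP ->; rewrite !subrr !mulr0 subrr normr0.
rewrite leq_eqVlt => /orP[/eqP <-|]; first by rewrite !subrr !mulr0 subrr normr0.
rewrite ltnS => jk H /=.
have nn : k.+1%:R * h = k%:R * h + h by rewrite -natr1 mulrDl mul1r.
have {}IH : `|euler f t0 y0 h k - euler f t0 y0 h j - p * (k%:R * h - j%:R * h)|
    <= e * (k%:R * h - j%:R * h).
  by apply: IH => // i /andP[ji ik]; rewrite H// ji ltnW.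
have {}H := H k (ltac:(by rewrite jk ltnSn)).
rewrite nn; set x := euler _ _ _ _ k in IH H *; set y := euler _ _ _ _ j in IH *.
have -> : x + h * f (t0 + k%:R * h, x) - y - p * (k%:R * h + h - j%:R * h) =
  (x - y - p * (k%:R * h - j%:R * h)) + (f (t0 + k%:R * h, x) - p) * h by ring.
have -> : e * (k%:R * h + h - j%:R * h) = e * (k%:R * h - j%:R * h) + e * h.
  by ring.
rewrite (le_trans (ler_normD _ _))// lerD// normrM (gtr0_norm h0).
by rewrite ler_wpM2r// ltW.
Qed.

(** The value at [t] is the Euler value at the last node not after [t]. Nodes lie less than [h] from
    their times, which accounts for the terms in [h] in [approx_solution]. *)
Lemma euler_approx (R : realType) (t0 t1 y0 b L : R) (f : R * R -> R) (h : R) :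
  0 < L -> 0 < h -> L * (t1 - t0) <= b -> bounded_on_rect t0 t1 y0 b L f ->
  approx_solution t0 t1 y0 b L f h
    (fun t => euler f t0 y0 h (Num.truncn ((t - t0) / h))).
Proof.
move=> L0 h0 Lb fL.
have hS n : n.+1%:R * h = n%:R * h + h by rewrite -natr1 mulrDl mul1r.
have nP t : t0 <= t -> let n := Num.truncn ((t - t0) / h) in
    n%:R * h <= t - t0 < n%:R * h + h.
  move=> tt /=; have q0 : 0 <= (t - t0) / h by rewrite divr_ge0 ?subr_ge0// ltW.
  have := truncn_itv q0.
  by rewrite ler_pdivlMr// ltr_pdivrMr// hS.
have bnd n : t0 + n%:R * h <= t1 -> `|euler f t0 y0 h n - y0| <= b.
  exact: euler_bound L0 h0 Lb fL.
have nh0 n : 0 <= n%:R * h by rewrite mulr_ge0// ltW.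
have fLn n : t0 + n%:R * h <= t1 ->
    `|f (t0 + n%:R * h, euler f t0 y0 h n)| <= L.
  by move=> nt; apply: fL; [rewrite nt lerDl nh0|exact: bnd].
have nle i j : (i <= j)%N -> i%:R * h <= j%:R * h.
  by move=> ij; rewrite ler_wpM2r ?ler_nat// ltW.
have nlt i j : (i < j)%N -> i%:R * h + h <= j%:R * h.
  by move=> /nle; rewrite hS.
have lip j k : (j <= k)%N -> t0 + k%:R * h <= t1 ->
    `|euler f t0 y0 h k - euler f t0 y0 h j| <= L * (k%:R * h - j%:R * h).
  move=> jk kt; rewrite -[X in `|X|]subr0 -(mul0r (k%:R * h - j%:R * h)).
  apply: euler_increment => // i /andP[_ /ltnW/nle ik]; rewrite subr0.
  by apply: fLn; lra.
split.
- by move=> t /andP[tt tt1]; have := nP t tt; rewrite /= => ?; apply: bnd; lra.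
- by rewrite subrr mul0r truncn0.
move=> s t p e sI tI K.
have := nP s (ltac:(lra)); have := nP t (ltac:(lra)) => /=.
set m := Num.truncn ((t - t0) / h); set n := Num.truncn ((s - t0) / h).
rewrite -/m -/n in K *; move=> mt ns.
have e0 : 0 <= e.
  apply: le_trans (K t _ tI (bnd m _) _ _); rewrite ?subrr ?normr0 //; first lra.
    by rewrite addr_ge0//; lra.
  by rewrite mulr_ge0// ?addr_ge0//; lra.
(* Replacing the distance between nodes by [s - t] changes it by at most [h]: this costs [|p| h] in
   the linear term and [e h] in the error. *)
have slack : forall E, `|E - p * (n%:R * h - m%:R * h)| <=
      e * `|n%:R * h - m%:R * h| ->
    `|E - p * (s - t)| <= e * `|s - t| + (`|p| + e) * h.
  move=> E EE; set x := n%:R * h - m%:R * h in EE.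
  have xh : `|x - (s - t)| <= h by rewrite ler_norml /x; lra.
  have -> : E - p * (s - t) = (E - p * x) + p * (x - (s - t)) by ring.
  apply: le_trans (ler_normD _ _) _; rewrite normrM.
  have : `|p| * `|x - (s - t)| <= `|p| * h by rewrite ler_wpM2l.
  have : e * `|x| <= e * (`|s - t| + h).
    rewrite ler_wpM2l//; have := ler_normD (x - (s - t)) (s - t).
    by rewrite subrK; lra.
  by lra.
apply: slack; case: (leqP m n) => [mn|/ltnW nm].
(* The nodes from [m] to [n - 1] have times between [t - h] and [s], hence lie in the box around
   [t]. *)
- rewrite [in leRHS]ger0_norm ?subr_ge0 ?nle//.
  apply: euler_increment => // i /andP[mi ik].
  have := nle _ _ mi; have := nlt _ _ ik => ik' mi'.
  have st0 : 0 <= s - t + h by lra.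
  have := ler_norm (s - t) => sts.
  apply: K; first by have := nh0 i; lra.
  + by apply: bnd; lra.
  + by rewrite ler_norml; lra.
  + apply: le_trans (lip _ _ mi _) _; first lra.
    by rewrite ler_wpM2l//; lra.
(* The increment is read backwards; node [n] may precede [s] by almost [h], which the box allows. *)
- rewrite [in leRHS]distrC [in leRHS]ger0_norm ?subr_ge0 ?nle//.
  have -> : euler f t0 y0 h n - euler f t0 y0 h m - p * (n%:R * h - m%:R * h) =
    - (euler f t0 y0 h m - euler f t0 y0 h n - p * (m%:R * h - n%:R * h)) by ring.
  rewrite normrN; apply: euler_increment => // i /andP[ni im].
  have := nle _ _ ni; have := nlt _ _ im => im' ni'.
  have := ler_norm (t - s); rewrite distrC => sts.
  apply: K; first by have := nh0 i; lra.
  + by apply: bnd; lra.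
  + by rewrite ler_norml; lra.
  + rewrite distrC; apply: le_trans (lip _ _ (ltnW im) _) _; first lra.
    by rewrite ler_wpM2l//; lra.
Qed.

(** * The upper envelope of the approximate solutions *)

(** The supremum is monotone in [h] by [approx_solution_le], so the infimum is its limit as [h]
    tends to 0. *)
Definition upper_envelope (R : realType) (t0 t1 y0 b L : R) (f : R * R -> R)
    (t : R) : R :=
  inf [set sup [set u t | u in approx_solution t0 t1 y0 b L f h] | h in
    [set h : R | 0 < h]].

Section envelope.
Context (R : realType) (t0 t1 y0 b L : R) (f : R * R -> R).
Hypotheses (t01 : t0 < t1) (L0 : 0 < L) (Lb : L * (t1 - t0) <= b).
Hypothesis fL : bounded_on_rect t0 t1 y0 b L f.

Local Notation approx := (approx_solution t0 t1 y0 b L f).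
Local Notation Phi := (upper_envelope t0 t1 y0 b L f).

Lemma approx_has_sup (h t : R) : 0 < h -> t0 <= t <= t1 ->
  has_sup [set u t | u in approx h].
Proof.
move=> h0 tI; split; first by eexists; eexists; first exact: euler_approx.
exists (y0 + b) => _ [u [ub _ _] <-]; have := ub t tI.
by rewrite ler_norml; lra.
Qed.

Lemma approx_sup_has_inf (t : R) : t0 <= t <= t1 ->
  has_inf [set sup [set u t | u in approx h] | h in [set h : R | 0 < h]].
Proof.
move=> tI; split; first by exists (sup [set u t | u in approx 1]); exists 1 => /=.
exists (y0 - b) => _ [h /= h0 <-].
have [[z uz] hub] := approx_has_sup h0 tI.
apply: le_trans (sup_upper_bound (approx_has_sup h0 tI) uz).
by case: uz => u [ub _ _] <-; have := ub t tI; rewrite ler_norml; lra.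
Qed.

Lemma eps_solution_le_envelope (phi : R -> R) (t : R) :
  eps_solution t0 t1 y0 b f phi -> t0 <= t <= t1 -> phi t <= Phi t.
Proof.
move=> sol tI; apply: lb_le_inf; first by have [] := approx_sup_has_inf tI.
move=> _ [h /= h0 <-]; apply: sup_upper_bound; first exact: approx_has_sup.
by exists phi => //; apply: eps_solution_approx.
Qed.

(** A single [u] serves both points. It is chosen nearly maximal at [t], so at [s] only an upper
    bound is available. *)
Lemma envelope_approx (s t h : R) : 0 < h -> t0 <= s <= t1 -> t0 <= t <= t1 ->
  exists u : R -> R, [/\ approx h u, `|u t - Phi t| <= h & u s <= Phi s + h].
Proof.
move=> h0 sI tI.
have [_ [hs /= hs0 <-] Hs] := inf_adherent h0 (approx_sup_has_inf sI).
have [_ [ht /= ht0 <-] Ht] := inf_adherent h0 (approx_sup_has_inf tI).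
(* A [k]-approximate solution is also [hs]- and [ht]-approximate, so both nearly optimal suprema
   bound it. *)
pose k := Num.min h (Num.min hs ht).
have k0 : 0 < k by rewrite !lt_min h0 hs0.
have [_ [u ku <-] Hu] := sup_adherent h0 (approx_has_sup k0 tI).
have le_sup x h' : t0 <= x <= t1 -> k <= h' ->
    u x <= sup [set u x | u in approx h'].
  move=> xI kh'; apply: sup_upper_bound.
    by apply: approx_has_sup => //; exact: lt_le_trans kh'.
  by exists u => //; apply: approx_solution_le ku.
exists u; split.
- by apply: approx_solution_le ku => //; rewrite ge_min lexx.
- have : u t <= sup [set u t | u in approx ht].
    by apply: le_sup => //; rewrite !ge_min lexx !orbT.
  have : Phi t <= sup [set u t | u in approx k].
    by apply: ge_inf; [have [] := approx_sup_has_inf tI | exists k].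
  by rewrite ler_norml; move: Ht Hu; rewrite -/(Phi t); lra.
- have : u s <= sup [set u s | u in approx hs].
    by apply: le_sup => //; rewrite !ge_min lexx !orbT.
  by move: Hs; rewrite -/(Phi s); lra.
Qed.

Lemma envelope_bound (t : R) : t0 <= t <= t1 -> `|Phi t - y0| <= b.
Proof.
move=> tI; apply: (@le_of_le_small _ _ _ 1 1) => // h h0 _.
have [u [[ub _ _] ut _]] := envelope_approx h0 tI tI.
have -> : Phi t - y0 = (u t - y0) - (u t - Phi t) by ring.
by rewrite mul1r (le_trans (ler_normB _ _))// lerD// ub.
Qed.

Lemma envelope_init : Phi t0 = y0.
Proof.
have tI : t0 <= t0 <= t1 by rewrite lexx ltW.
apply/eqP; rewrite -subr_eq0 -normr_le0.
apply: (@le_of_le_small _ _ _ 1 1) => // h h0 _.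
have [u [[_ u0 _] ut _]] := envelope_approx h0 tI tI.
by rewrite u0 distrC in ut; rewrite add0r mul1r.
Qed.

(** The functions [u] of [envelope_approx] transfer only the lower half of their slope estimate to
    the envelope; the upper half comes later, by exchanging [s] and [t]. *)
Lemma envelope_slope_ge (s t p e g : R) : 0 < g ->
  t0 <= s <= t1 -> t0 <= t <= t1 ->
  (forall r y : R, t0 <= r <= t1 -> `|y - y0| <= b ->
    `|r - t| <= `|s - t| + g -> `|y - Phi t| <= L * `|s - t| + g ->
    `|f (r, y) - p| <= e) ->
  - (e * `|s - t|) <= Phi s - Phi t - p * (s - t).
Proof.
move=> g0 sI tI K.
have e0 : 0 <= e.
  by apply: le_trans (K t (Phi t) tI (envelope_bound tI) _ _) => //;
    rewrite subrr normr0 addr_ge0// ?mulr_ge0// ltW.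
have L1 : 0 < L + 1 by rewrite addr_gt0.
(* The [2] pays for an error [h] at each of [s] and [t]. The bound [g / (L + 1)] gives
   [L h + h <= g], so the box around [u t] fits in the one around [Phi t]. *)
apply: (@le_of_le_small _ _ _ (`|p| + e + 2) (Num.min g (g / (L + 1)))).
- by rewrite !addr_ge0.
- by rewrite lt_min g0 divr_gt0.
move=> h h0; rewrite le_min ler_pdivlMr// => /andP[hg hLg].
have [u [[_ _ H] ut us]] := envelope_approx h0 sI tI.
have := H s t p e sI tI; rewrite ler_norml => /(_ _)/andP[].
  move=> r y rI yb rt yt; apply: K => //; first by rewrite (le_trans rt)// lerD2l.
  have -> : y - Phi t = (y - u t) + (u t - Phi t) by ring.
  by rewrite (le_trans (ler_normD _ _))//; lra.
move: ut; rewrite ler_norml; lra.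
Qed.

Lemma envelope_lipschitz (s t : R) : t0 <= s <= t1 -> t0 <= t <= t1 ->
  `|Phi s - Phi t| <= L * `|s - t|.
Proof.
move=> sI tI.
(* Slope [0] with error [L]; the margin [1] is arbitrary, as [L] bounds [f] on the whole
   rectangle. *)
have H s' t' : t0 <= s' <= t1 -> t0 <= t' <= t1 ->
    - (L * `|s' - t'|) <= Phi s' - Phi t' - 0 * (s' - t').
  move=> sI' tI'; apply: envelope_slope_ge ltr01 _ _ _ => // r y rI yb _ _.
  by rewrite subr0 fL.
have := H _ _ sI tI; have := H _ _ tI sI; rewrite distrC ler_norml; lra.
Qed.

Lemma envelope_solution : continuous_on_rect t0 t1 y0 b f ->
  eps_solution t0 t1 y0 b f Phi.
Proof.
move=> fc; split; [exact: envelope_bound|exact: envelope_init|].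
move=> t tI e e0; have [d d0 Hd] := fc t (Phi t) tI (envelope_bound tI) e e0.
have L1 : 0 < L + 1 by rewrite addr_gt0.
have L4 : 0 < 4 * (L + 1) by rewrite mulr_gt0.
(* Both [2 |s - t|] and [2 L |s - t|] are then at most [d / 2], leaving the margin [d / 2]; the
   factor 2 is for boxes centred at [s]. *)
exists (d / (4 * (L + 1))); first by rewrite divr_gt0.
move=> s sI; rewrite ler_pdivlMr// => st.
have st0 : 0 <= `|s - t| by [].
have Lst0 : 0 <= L * `|s - t| by rewrite mulr_ge0// ltW.
have d2 : 0 < d / 2 by rewrite divr_gt0.
have lo : - (e * `|s - t|) <= Phi s - Phi t - f (t, Phi t) * (s - t).
  apply: (envelope_slope_ge d2 sI tI) => r y rI yb rt yt.
  by apply: Hd => //; lra.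
(* With [s] and [t] exchanged, the box is centred at [(s, Phi s)]; the Lipschitz bound keeps it
   within [d] of [(t, Phi t)]. *)
have up : - (e * `|t - s|) <= Phi t - Phi s - f (t, Phi t) * (t - s).
  apply: (envelope_slope_ge d2 tI sI) => r y rI yb rs ys.
  have lip := envelope_lipschitz sI tI.
  apply: Hd => //.
    have := ler_normD (r - s) (s - t).
    rewrite (_ : r - s + (s - t) = r - t); last by ring.
    by move: rs; rewrite (distrC t s); lra.
  have := ler_normD (y - Phi s) (Phi s - Phi t).
  rewrite (_ : y - Phi s + (Phi s - Phi t) = y - Phi t); last by ring.
  by move: ys; rewrite (distrC t s); lra.
by rewrite distrC in up; rewrite ler_norml; lra.
Qed.

End envelope.

(** * Reflection, and return to the original formulation *)

Lemma eps_solution_opp (R : realType) (t0 t1 y0 b : R) (f : R * R -> R)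
    (phi : R -> R) : eps_solution t0 t1 y0 b f phi ->
  eps_solution t0 t1 (- y0) b (fun z => - f (z.1, - z.2)) (fun t => - phi t).
Proof.
move=> [phib phi0 D]; split; last 1 first.
- move=> t tI e e0; have [d d0 Hd] := D t tI e e0; exists d => // s sI st /=.
  rewrite (opprK (phi t)) (_ : _ - _ = - (phi s - phi t - f (t, phi t) * (s - t))).
    by rewrite normrN; exact: Hd.
  by ring.
- by move=> t tI; rewrite -opprD normrN phib.
- by rewrite phi0.
Qed.

Lemma is_solution_eps (R : realType) (t0 y0 a b c : R) (f : R * R -> R)
    (phi : R -> R) : 0 < c -> c <= a ->
  is_solution (`[t0, t0 + a]%classic `*` `[y0 - b, y0 + b]%classic) f t0 y0
    t0 (t0 + c) phi <-> eps_solution t0 (t0 + c) y0 b f phi.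
Proof.
move=> c0 ca; split=> -[phib phi0 D]; split=> //.
- move=> t tI; have := phib t; rewrite in_itv/= => /(_ tI)[/= _].
  by rewrite in_itv/= ler_norml; lra.
- by apply: has_derivative_on_eps D; lra.
- move=> t; rewrite in_itv/= => tI; split; rewrite /= in_itv/=; first lra.
  by have := phib t tI; rewrite ler_norml; lra.
- by apply: eps_has_derivative_on D; lra.
Qed.

Lemma within_continuous_on_rect (R : realType) (t0 y0 a b c : R)
    (f : R * R -> R) : c <= a ->
  {within `[t0, t0 + a]%classic `*` `[y0 - b, y0 + b]%classic, continuous f} ->
  continuous_on_rect t0 (t0 + c) y0 b f.
Proof.
move=> ca /subspace_continuousP fc t y tI yb e e0.
have rectP r z : t0 <= r <= t0 + c -> `|z - y0| <= b ->
    (`[t0, t0 + a]%classic `*` `[y0 - b, y0 + b]%classic) (r, z).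
  by rewrite ler_norml => rI zb; split; rewrite /= in_itv/=; lra.
have := fc (t, y) (rectP _ _ tI yb).
move/cvgrPdist_le => /(_ _ e0)/nbhs_ballP[d /= d0 Hd].
exists (d / 2); first by rewrite divr_gt0.
move=> r z rI zb rt zy; rewrite distrC; apply: Hd; last exact: rectP.
by split; rewrite /ball/= distrC; lra.
Qed.

Theorem theorem3p1 (R : realType) (t0 y0 a b L : R) (f : R * R -> R)
    (a_gt0 : 0 < a) (b_gt0 : 0 < b) (L_gt0 : 0 < L) :
  let D : set (R * R) :=
    `[t0, t0 + a]%classic `*` `[y0 - b, y0 + b]%classic in
  let c : R := Num.min a (b / L) in
  {within D, continuous f} ->
  (forall t y : R, D (t, y) -> `|f (t, y)| <= L) ->
  exists phi_lo phi_up : R -> R,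
    [/\ is_solution D f t0 y0 t0 (t0 + c) phi_lo,
        is_solution D f t0 y0 t0 (t0 + c) phi_up
      & forall phi : R -> R, is_solution D f t0 y0 t0 (t0 + c) phi ->
        forall t : R, t \in `[t0, t0 + c] ->
          phi_lo t <= phi t <= phi_up t].
Proof.
move=> D c fc fL.
have c0 : 0 < c by rewrite lt_min a_gt0 divr_gt0.
have ca : c <= a by rewrite ge_min lexx.
have t01 : t0 < t0 + c by rewrite ltrDl.
(* From [c <= b / L]: a slope of at most [L] cannot leave the rectangle before [t0 + c]. *)
have Lb : L * (t0 + c - t0) <= b.
  by rewrite addrAC subrr add0r mulrC -ler_pdivlMr// ge_min lexx orbT.
have {}fL : bounded_on_rect t0 (t0 + c) y0 b L f.
  move=> t y tI; rewrite ler_norml => yb; apply: fL.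
  by split; rewrite /= in_itv/=; lra.
have {}fc := within_continuous_on_rect ca fc.
pose g z := - f (z.1, - z.2).
have oppb z : `|z - - y0| = `|- z - y0| by rewrite -opprD normrN opprK.
have gL : bounded_on_rect t0 (t0 + c) (- y0) b L g.
  by move=> t y tI; rewrite oppb normrN => /fL; apply.
have gc : continuous_on_rect t0 (t0 + c) (- y0) b g.
  move=> t y tI; rewrite oppb => yb e e0; have [d d0 Hd] := fc t _ tI yb e e0.
  exists d => // r z rI; rewrite oppb => zb rt zy.
  rewrite /g/= -opprD normrN.
  by apply: Hd => //; rewrite -opprD normrN.
have upf := envelope_solution t01 L_gt0 Lb fL fc.
have upg := envelope_solution t01 L_gt0 Lb gL gc.
(* Reflecting twice gives back [f], so minus the envelope for [g] solves the original problem. *)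
have := eps_solution_opp upg; rewrite opprK (_ : (fun z => _) = f); last first.
  by apply/funext => -[r z]; rewrite /g/= !opprK.
move=> lof; do 2 eexists; split; [exact/is_solution_eps/lof|exact/is_solution_eps/upf|].
move=> phi /is_solution_eps - /(_ c0 ca) sol t; rewrite in_itv/= => tI.
(* The lower bound is the upper one for [- phi], a solution for [g]. *)
rewrite (eps_solution_le_envelope t01 L_gt0 Lb fL sol tI) andbT lerNl.
exact: (eps_solution_le_envelope t01 L_gt0 Lb gL (eps_solution_opp sol) tI).
Qed.
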